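(* (Convergence of discrete latent dynamics models.) Fix $\boldsymbol{\mu}\in\mathcal{P}$. Let $\Psi':\mathbb{R}^n\to\mathbb{R}^{N_h}$ be Lipschitz continuous with constant $Lip(\Psi')$, let $\tilde{\mathbf{u}}_h(t)=\Psi'(\mathbf{u}_n(t))$ be the time-continuous latent dynamics model approximation and let $\tilde{\mathbf{u}}_h^k=\Psi'(\mathbf{u}_n^k)$ be its discrete counterpart obtained with step $\Delta t$ (see context). If the one-step method used for the latent problem is convergent of order $p$, i.e. $\|\mathbf{u}_n(t_k)-\mathbf{u}_n^k\|\le C\Delta t^p$ for all $k=0,\dots,N_{\Delta t}$ with $C>0$ independent of $\Delta t$ and $k$, then $$\|\tilde{\mathbf{u}}_h(t_k)-\tilde{\mathbf{u}}_h^k\|\le Lip(\Psi')\,C\,\Delta t^p\qquad\forall k=0,\dots,N_{\Delta t};$$ in particular $\lim_{\Delta t\to0}\|\tilde{\mathbf{u}}_h(t_k)-\tilde{\mathbf{u}}_h^k\|=0$ for all $k=0,\dots,N_{\Delta t}$.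
   Context: $\mathcal{P}\subset\mathbb{R}^{n_\mu}$ is compact, $\|\cdot\|$ is the Euclidean norm, $n\ll N_h$. The latent state solves $\dot{\mathbf{u}}_n(t)=\mathbf{f}_n(t,\mathbf{u}_n(t);\boldsymbol{\mu})$ for $t\in(t_0,T]$, $\mathbf{u}_n(t_0)=\Psi(\mathbf{u}_{0,h}(\boldsymbol{\mu}))$, where $\Psi:\mathbb{R}^{N_h}\to\mathbb{R}^n$ is Lipschitz and $\mathbf{u}_{0,h}(\boldsymbol{\mu})\in\mathbb{R}^{N_h}$ is the full-order initial value. $[t_0,T]$ is divided into $N_{\Delta t}$ intervals of width $\Delta t$, $t_k=t_0+k\Delta t$. The discrete latent state is produced by an explicit one-step (Runge-Kutta) scheme with increment function $\Phi$: $\mathbf{u}_n^k=\mathbf{u}_n^{k-1}+\Delta t\,\Phi(t_{k-1},\mathbf{u}_n^{k-1};\Delta t,\mathbf{f}_n,\boldsymbol{\mu})$ for $k=1,\dots,N_{\Delta t}$, $\mathbf{u}_n^0=\Psi(\mathbf{u}_{0,h}(\boldsymbol{\mu}))$. *)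

(* Defs.v *)
From HB Require Import structures.
From mathcomp Require Import all_boot all_order all_algebra.
From mathcomp Require Import all_classical all_reals all_analysis.
Set Implicit Arguments.
Unset Strict Implicit.
Unset Printing Implicit Defensive.
Import Order.TTheory GRing.Theory Num.Theory.
Import numFieldNormedType.Exports.
Local Open Scope classical_set_scope.
Local Open Scope ring_scope.

(* The canonical norm of the library on matrices is the sup norm, hence this
   explicit Euclidean norm; both induce the same topology on R^m. *)
Definition enorm (R : realType) (m : nat) (x : 'rV[R]_m) : R :=
  Num.sqrt (\sum_(i < m) x 0 i ^+ 2).

Definition elipschitz_with (R : realType) (m q : nat) (L : R)
    (g : 'rV[R]_m -> 'rV[R]_q) : Prop :=
  0 <= L /\ forall x y, enorm (g x - g y) <= L * enorm (x - y).

Definition elipschitz (R : realType) (m q : nat)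
    (g : 'rV[R]_m -> 'rV[R]_q) : Prop :=
  exists L : R, elipschitz_with L g.

(* Derivative of u at t relative to the set A (u may be arbitrary outside A):
   on an interval this is the usual derivative at interior points and the
   one-sided one at end points. *)
Definition has_derivative_within (R : realType) (m : nat) (A : set R)
    (u : R -> 'rV[R]_m) (t : R) (v : 'rV[R]_m) : Prop :=
  (s - t)^-1 *: (u s - u t) @[s --> within A t^'] --> v.

(* u' = F(t, u) on ]t0, T] and u(t0) = x0.  Continuity on [t0, T] is what ties
   the initial value to the equation, which is only imposed for t > t0. *)
Definition is_ivp_solution (R : realType) (m : nat) (t0 T : R)
    (F : R -> 'rV[R]_m -> 'rV[R]_m) (x0 : 'rV[R]_m)
    (u : R -> 'rV[R]_m) : Prop :=
  [/\ {within `[t0, T], continuous u},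
      forall t, t \in `]t0, T] -> has_derivative_within `[t0, T] u t (F t (u t))
    & u t0 = x0].

(* The step sizes dt for which [t0, T] splits into a whole number of intervals
   of width dt; that number is [nb_steps t0 T dt]. *)
Definition stepsize (R : realType) (t0 T : R) : set R :=
  [set dt | 0 < dt /\ exists N : nat, N%:R * dt = T - t0].

Definition nb_steps (R : realType) (t0 T dt : R) : nat :=
  Num.truncn ((T - t0) / dt).

Definition grid (R : realType) (t0 dt : R) (k : nat) : R := t0 + k%:R * dt.

(* An increment function takes, in this order: the time, the state, the step
   size, the right-hand side and the parameter. *)
Definition increment (R : realType) (m q : nat) : Type :=
  R -> 'rV[R]_m -> R -> (R -> 'rV[R]_m -> 'rV[R]_q -> 'rV[R]_m) ->
  'rV[R]_q -> 'rV[R]_m.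

Fixpoint one_step (R : realType) (m q : nat) (Phi : increment R m q)
    (f : R -> 'rV[R]_m -> 'rV[R]_q -> 'rV[R]_m) (mu : 'rV[R]_q)
    (x0 : 'rV[R]_m) (t0 dt : R) (k : nat) {struct k} : 'rV[R]_m :=
  if k is k'.+1 then
    let x := one_step Phi f mu x0 t0 dt k' in
    x + dt *: Phi (grid t0 dt k') x dt f mu
  else x0.

(* Main.v *)
Require Import Defs.
From HB Require Import structures.
From mathcomp Require Import all_boot all_order all_algebra.
From mathcomp Require Import all_classical all_reals all_analysis.
Import Order.TTheory GRing.Theory Num.Theory.
Import numFieldNormedType.Exports.
Local Open Scope classical_set_scope.
Local Open Scope ring_scope.

(** The decoder Psi' enlarges distances by at most its Lipschitz constant, so
    the latent error bound C * dt `^ p becomes LipPsi' * C * dt `^ p after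
    decoding. This bound does not involve the grid index and tends to 0 with dt
    because p > 0 (lemma [powR_cvg0]); hence the decoded error is squeezed to 0
    even when the index varies with dt. *)

Theorem mainTheorem4 (R : realType) (nmu n Nh : nat) (hn : (n < Nh)%N)
  (P : set 'rV[R]_nmu) (hP : compact P)
  (t0 T : R) (hT : t0 < T)
  (fn : R -> 'rV[R]_n -> 'rV[R]_nmu -> 'rV[R]_n)
  (Psi : 'rV[R]_Nh -> 'rV[R]_n) (hPsi : elipschitz Psi)
  (u0h : 'rV[R]_nmu -> 'rV[R]_Nh)
  (Phi : increment R n nmu)
  (mu : 'rV[R]_nmu) (hmu : P mu)
  (un : R -> 'rV[R]_n)
  (hun : is_ivp_solution t0 T (fun t x => fn t x mu) (Psi (u0h mu)) un)
  (Psi' : 'rV[R]_n -> 'rV[R]_Nh) (LipPsi' : R)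
  (hPsi' : elipschitz_with LipPsi' Psi')
  (p : R) (hp : 0 < p) (C : R) (hC : 0 < C)
  (hconv : forall dt, stepsize t0 T dt ->
     forall k, (k <= nb_steps t0 T dt)%N ->
       enorm (un (grid t0 dt k) - one_step Phi fn mu (Psi (u0h mu)) t0 dt k)
         <= C * dt `^ p) :
  let ut (t : R) := Psi' (un t) in
  let utk (dt : R) (k : nat) :=
    Psi' (one_step Phi fn mu (Psi (u0h mu)) t0 dt k) in
  (forall dt, stepsize t0 T dt ->
     forall k, (k <= nb_steps t0 T dt)%N ->
       enorm (ut (grid t0 dt k) - utk dt k) <= LipPsi' * C * dt `^ p)
  /\
  (* the grid index may depend on dt: this covers both a fixed index and, e.g.,
     the index of a fixed time, and amounts to uniformity in the index *)
  (forall k : R -> nat,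
     (\forall dt \near within (stepsize t0 T) 0^'+,
        (k dt <= nb_steps t0 T dt)%N) ->
     enorm (ut (grid t0 dt (k dt)) - utk dt (k dt))
       @[dt --> within (stepsize t0 T) 0^'+] --> (0 : R)).
Proof.
move=> ut utk; case: hPsi' => L_ge0 lipPsi'.
have error_le dt : stepsize t0 T dt -> forall k, (k <= nb_steps t0 T dt)%N ->
    enorm (ut (grid t0 dt k) - utk dt k) <= LipPsi' * C * dt `^ p.
  move=> hdt k hk; rewrite -mulrA; apply: le_trans (lipPsi' _ _) _.
  by apply: ler_wpM2l => //; exact: hconv.
split=> // k hk.
apply: (squeeze_cvgr (f := fun=> 0) (h := fun dt => LipPsi' * C * dt `^ p)).
- (* Membership of dt in the set of step sizes holds near 0 only because the
     filter is restricted to that set. *)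
  near=> dt; rewrite sqrtr_ge0 /=; apply: error_le; last by near: dt.
  by near: dt; exact: withinT.
- exact: cvg_cst.
- apply: cvg_within_filter.
  have := cvgM (cvg_cst (LipPsi' * C)) (powR_cvg0 hp).
  by rewrite mulr0; apply.
Unshelve. all: by end_near.
Qed.
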